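(* For any strict partition $\lambda$ and positive odd integer $r$, $$r\,t_r\,Q_\lambda=\sum_{i=1}^{l(\lambda)}Q_{\lambda+r\epsilon_i}+\frac12Q_{(\lambda,r)}+\sum_{k=1}^{r-1}\frac{(-1)^{r-k}}4\,Q_{(\lambda,k,r-k)}.$$
   Context: Partitions: a partition of length $l(\lambda)=l$ is a finite sequence $\lambda=(\lambda_1,\dots,\lambda_l)$ of non-negative integers (in any order). It is strict if $\lambda_1>\cdots>\lambda_l>0$ (the empty partition $\emptyset$ counts as strict), positive if all parts are positive, and weakly positive if at most one part is $0$. Notation: $\lambda+r\epsilon_i=(\lambda_1,\dots,\lambda_i+r,\dots,\lambda_l)$, and $(\lambda,a_1,\dots,a_s)=(\lambda_1,\dots,\lambda_l,a_1,\dots,a_s)$. Schur Q-polynomials in $\mathbf t=(t_1,t_3,t_5,\dots)$ (normalized as in Macdonald's book): define $q_k(\mathbf t)$ by $\sum_{k\ge0}q_k(\mathbf t)z^k=\exp\big(2\sum_{k\ge0}t_{2k+1}z^{2k+1}\big)$. For non-negative integers $(r,s)\ne(0,0)$ put $M_{(r,s)}=q_rq_s+2\sum_{i=1}^s(-1)^iq_{r+i}q_{s-i}$, and $M_{(0,0)}=0$. For a weakly positive partition $\lambda=(\lambda_1,\dots,\lambda_{2m})$ of even length, $Q_\lambda(\mathbf t)=\mathrm{Pf}(M_{(\lambda_i,\lambda_j)})_{1\le i,j\le 2m}$; for positive $\lambda$ of odd length, $Q_\lambda=Q_{(\lambda,0)}$. The definition is extended to all partitions by: (i) if $\tilde\lambda$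 is obtained from $\lambda$ by switching adjacent parts $\lambda_i,\lambda_{i+1}$ that are not both $0$, then $Q_{\tilde\lambda}=-Q_\lambda$; (ii) $Q_{(\lambda,0)}=Q_\lambda$ for all $\lambda$; (iii) $Q_\emptyset=1$. In particular $Q_\lambda=0$ if $\lambda$ has two equal positive parts. *)

(* Defs.v *)
From mathcomp Require Import all_boot all_order all_fingroup all_algebra.
From mathcomp Require Import monalg.

Set Implicit Arguments.
Unset Strict Implicit.
Unset Printing Implicit Defensive.

Import GRing.Theory.
Local Open Scope ring_scope.

Section SchurQ.
Variable R : comAlgType rat.

(* The coefficient of z^k in exp (\sum_j f j * z^j), where f 0 = 0: then only
   the powers of exponent n <= k, and the terms f j with j <= k, contribute. *)
Definition exp_coef (f : nat -> R) (k : nat) : R :=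
  \sum_(n < k.+1) (n`!%:R : rat)^-1 *: ((\poly_(j < k.+1) f j) ^+ n)`_k.

Definition ord_even m (i : 'I_m) : 'I_m.*2 :=
  Ordinal (etrans (ltn_double i m) (ltn_ord i)).
Definition ord_odd m (i : 'I_m) : 'I_m.*2 :=
  Ordinal (etrans (ltn_Sdouble i m) (ltn_ord i)).

Definition Pf m (A : 'M[R]_(m.*2)) : R :=
  ((2 ^ m * m`!)%:R : rat)^-1 *:
    \sum_(s : 'S_(m.*2))
      (-1) ^+ s * \prod_(i < m) A (s (ord_even i)) (s (ord_odd i)).

(* t r is the value of t_r; it is used only for odd r. *)
Variable t : nat -> R.

Definition q (k : nat) : R := exp_coef (fun j => if odd j then 2 * t j else 0) k.

Definition M (r s : nat) : R :=
  if (r == 0)%N && (s == 0)%N then 0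
  else q r * q s + 2 * \sum_(1 <= i < s.+1) (-1) ^+ i * q (r + i) * q (s - i).

(* Meaningful for s of even length, where (size s)./2.*2 = size s. *)
Definition PfM (s : seq nat) : R :=
  Pf (\matrix_(i < (size s)./2.*2, j < (size s)./2.*2)
        M (nth 0%N s i) (nth 0%N s j)).

End SchurQ.

Definition weakly_positive (s : seq nat) : bool := (count_mem 0%N s <= 1)%N.
Definition positive_part (s : seq nat) : seq nat := [seq a <- s | (0 < a)%N].

(* The number of pairs i < j with s_i = 0 < s_j. *)
Fixpoint zero_inv (s : seq nat) : nat :=
  if s is a :: s' then
    ((if a == 0 then count (fun b => 0 < b) s' else 0) + zero_inv s')%N
  else 0%N.

(* Rule (i) moves the zeros to the end, at the cost of (-1) ^+ zero_inv lam, and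
   rule (ii) then removes them; a positive partition of odd length is completed
   by one zero.  The rules (i), (ii), (iii) are schurQ_swap, schurQ_rcons0 and
   schurQ_nil below. *)
Definition schurQ (R : comAlgType rat) (t : nat -> R) (lam : seq nat) : R :=
  if weakly_positive lam && ~~ odd (size lam) then PfM t lam
  else let mu := positive_part lam in
    (-1) ^+ zero_inv lam * PfM t (if odd (size mu) then rcons mu 0%N else mu).

Section Rules.
Variables (R : comAlgType rat) (t : nat -> R).

Lemma Pf_perm m (A : 'M[R]_(m.*2)) (u : 'S_(m.*2)) :
  Pf (\matrix_(i, j) A (u i) (u j)) = (-1) ^+ u * Pf A.
Proof.
rewrite /Pf -scalerAr mulr_sumr; congr (_ *: _).
rewrite [RHS](reindex_inj (mulIg u)) /=; apply: eq_bigr => s _.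
rewrite odd_permM signr_addb.
transitivity ((-1) ^+ u * ((-1) ^+ u * ((-1) ^+ s *
    \prod_(i < m) A ((s * u)%g (ord_even i)) ((s * u)%g (ord_odd i)))) : R);
  last by congr (_ * _); rewrite [in RHS](mulrC ((-1) ^+ s)) mulrA.
rewrite signrMK.
by congr (_ * _); apply: eq_bigr => i _; rewrite !mxE !permM.
Qed.

Lemma PfM_sizeE m s : (size s)./2 = m ->
  PfM t s = Pf (\matrix_(i < m.*2, j < m.*2) M t (nth 0%N s i) (nth 0%N s j)).
Proof. by move=> <-. Qed.

Lemma PfM_swap s1 a b s2 : ~~ odd (size s1 + size s2) ->
  PfM t (s1 ++ b :: a :: s2) = - PfM t (s1 ++ a :: b :: s2).
Proof.
move=> ev; pose m := (size s1 + size s2)./2.+1.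
have sz c d : (size (s1 ++ c :: d :: s2))./2 = m by rewrite size_cat /= !addnS.
rewrite !(PfM_sizeE (sz _ _)).
have em : m.*2 = (size s1 + size s2).+2.
  by rewrite /m doubleS halfK (negbTE ev) subn0.
have lt1 : (size s1 < m.*2)%N by rewrite em ltnS leqW // leq_addr.
have lt2 : ((size s1).+1 < m.*2)%N by rewrite em !ltnS leq_addr.
pose x := Ordinal lt1; pose y := Ordinal lt2.
have nxy : x != y by rewrite -val_eqE /= neq_ltn ltnSn.
have nthE (i : 'I_(m.*2)) : nth 0%N (s1 ++ b :: a :: s2) i
    = nth 0%N (s1 ++ a :: b :: s2) (tperm x y i).
  case: tpermP => [-> | -> | nx ny] /=.
  - by rewrite !nth_cat ltnn subnn ltnNge leqnSn /= subSnn.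
  - by rewrite !nth_cat ltnn subnn ltnNge leqnSn /= subSnn.
  rewrite !nth_cat; case: ltnP => // le.
  move: nx ny => /eqP nx /eqP ny; rewrite -!val_eqE /= in nx ny.
  have : ((size s1).+2 <= i)%N.
    by rewrite ltn_neqAle eq_sym ny ltn_neqAle eq_sym nx.
  by move/subnK => <-; rewrite -[(size s1).+2]addn2 addnCA addKn addn2.
have -> : - Pf (\matrix_(i < m.*2, j < m.*2)
      M t (nth 0%N (s1 ++ a :: b :: s2) i) (nth 0%N (s1 ++ a :: b :: s2) j))
    = (-1) ^+ tperm x y * Pf (\matrix_(i < m.*2, j < m.*2)
      M t (nth 0%N (s1 ++ a :: b :: s2) i) (nth 0%N (s1 ++ a :: b :: s2) j)).
  by rewrite odd_tperm nxy expr1 mulN1r.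
rewrite -Pf_perm; congr Pf; apply/matrixP => i j.
by rewrite !mxE !nthE.
Qed.

Lemma positive_part_id s : 0%N \notin s -> positive_part s = s.
Proof.
move=> s0; apply/all_filterP/allP => a sa; rewrite lt0n.
by apply: contraNneq s0 => <-.
Qed.

Lemma zero_inv_cat s1 s2 : 0%N \notin s1 ->
  zero_inv (s1 ++ s2) = zero_inv s2.
Proof.
elim: s1 => //= a s1 IHs; rewrite inE negb_or eq_sym => /andP[/negbTE-> /IHs].
by rewrite add0n.
Qed.

Lemma PfM_zero s1 s2 : 0%N \notin s1 -> 0%N \notin s2 ->
  odd (size s1 + size s2) ->
  PfM t (s1 ++ 0%N :: s2) = (-1) ^+ size s2 * PfM t (rcons (s1 ++ s2) 0%N).
Proof.
elim: s2 s1 => [|b s2 IHs] s1 s10 /=; first by rewrite !cats0 cats1 mul1r.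
rewrite inE negb_or => /andP[b0 s20] od.
rewrite PfM_swap; last by move: od; rewrite addnS.
rewrite -cat_rcons IHs //; last by rewrite size_rcons addSnnS.
  by rewrite cat_rcons exprS mulN1r mulNr.
by rewrite mem_rcons inE negb_or b0.
Qed.

Lemma schurQE s : schurQ t s =
  let mu := positive_part s in
  (-1) ^+ zero_inv s * PfM t (if odd (size mu) then rcons mu 0%N else mu).
Proof.
rewrite /schurQ /=; case: ifP => // /andP[wp ev].
have [s0|s0] := boolP (0%N \in s); last first.
  rewrite positive_part_id // (negbTE ev).
  by rewrite -[s in zero_inv s]cats0 zero_inv_cat // mul1r.
case/splitPr: s0 wp ev => s1 s2; rewrite /weakly_positive count_cat /= addnCA.
rewrite add1n ltnS leqn0 addn_eq0 !eqn0Ngt -!has_count !has_pred1.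
case/andP=> s10 s20.
rewrite size_cat /= addnS /= negbK => od.
rewrite zero_inv_cat //= /positive_part filter_cat /= -/(positive_part _).
rewrite -/(positive_part s2) !positive_part_id // size_cat od PfM_zero //.
congr ((-1) ^+ _ * _).
rewrite -[s2 in zero_inv s2]cats0 zero_inv_cat // addn0.
by rewrite -size_filter -/(positive_part _) positive_part_id.
Qed.

Lemma schurQ_swap s1 a b s2 : ~~ ((a == 0%N) && (b == 0%N)) ->
  schurQ t (s1 ++ b :: a :: s2) = - schurQ t (s1 ++ a :: b :: s2).
Proof.
move=> nab; rewrite !schurQE /= /positive_part !filter_cat /= !lt0n.
have zi u v n : count (fun e => 0 < e)%N u = count (fun e => 0 < e)%N v ->
    zero_inv u = (n + zero_inv v)%N ->
    zero_inv (s1 ++ u) = (n + zero_inv (s1 ++ v))%N.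
  move=> cuv zuv; elim: {nab} s1 => //= c s ->.
  by rewrite !count_cat cuv addnCA.
have sg u v p : zero_inv (s1 ++ u) = (1 + zero_inv (s1 ++ v))%N ->
    (-1) ^+ zero_inv (s1 ++ u) * p = - ((-1) ^+ zero_inv (s1 ++ v) * p) :> R.
  by move=> ->; rewrite exprS mulN1r mulNr.
have [a0|a0] := eqVneq a 0%N; have [b0|b0] := eqVneq b 0%N.
- by rewrite a0 b0 in nab.
- rewrite /= (sg (a :: b :: s2) (b :: a :: s2)) ?opprK //; apply: zi; rewrite /= a0 ?lt0n b0 //=.
  by rewrite (negbTE b0) !add0n addnA.
- rewrite /= (sg (b :: a :: s2) (a :: b :: s2)) //; apply: zi; rewrite /= b0 ?lt0n a0 //=.
  by rewrite (negbTE a0) !add0n addnA.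
rewrite (zi (b :: a :: s2) (a :: b :: s2) 0%N); first last.
- by rewrite /= (negbTE a0) (negbTE b0).
- by rewrite /= !lt0n a0 b0.
rewrite add0n -mulrN !size_cat /= !addnS /= negbK; congr (_ * _).
case: ifP => od; last by rewrite PfM_swap ?od.
by rewrite !rcons_cat !rcons_cons PfM_swap // size_rcons addnS /= od.
Qed.

Lemma schurQ_rcons0 s : schurQ t (rcons s 0%N) = schurQ t s.
Proof.
rewrite !schurQE /positive_part filter_rcons /=.
congr ((-1) ^+ _ * _); elim: s => //= a s ->.
by rewrite -cats1 count_cat /= !addn0.
Qed.

Lemma Pf0 (A : 'M[R]_(0.*2)) : Pf A = 1.
Proof.
rewrite /Pf (big_pred1 1%g) => [|s]; last first.
  by apply/esym/eqP/permP => -[].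
by rewrite big_ord0 odd_perm1 mulr1 scale1r.
Qed.

Lemma schurQ_nil : schurQ t [::] = 1.
Proof. exact: Pf0. Qed.

End Rules.

Definition strict (lam : seq nat) : bool :=
  sorted gtn lam && (0%N \notin lam).

(* lam + r epsilon_i, with the parts indexed from 0. *)
Definition add_part (lam : seq nat) (r i : nat) : seq nat :=
  set_nth 0%N lam i (nth 0%N lam i + r)%N.

(* The polynomial ring rat[t_1, t_3, t_5, ...]: the variable of index k
   stands for t_(2k+1), so tvar r is t_r for odd r. *)
Definition Qt : comAlgType rat := {malg rat[{cmonom nat}]}.
Definition tvar (r : nat) : Qt := << ucm r./2 >>.

(* Main.v *)
(* Let A be the matrix of the M_(s_i,s_j), for s of even length.  Expanding along
   the last two rows, Pf (s, k, r - k) is M_(k,r-k) Pf A plus a derivative of Pf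
   at A; \sum_i Q_(s + r epsilon_i) is also a derivative of Pf at A.  For odd r,
   the two directions are multiples of each other, since
     \sum_(l <= r) (-1)^l M_(a,l) M_(b,r-l) = - 2 (M_(a+r,b) + M_(a,b+r))
   for a, b > 0, by induction on r from q(z) q(-z) = 1.  The multiples of Pf A
   match because 4 r t_r = \sum_(k <= r) (-1)^(r-k) M_(k,r-k), which comes from
   the logarithmic derivative z q'(z) q(-z) = 2 \sum_(r odd) r t_r z^r. *)
From mathcomp Require Import all_boot all_order all_fingroup all_algebra.
From mathcomp Require Import monalg ring.
Require Import Defs.

Set Implicit Arguments.
Unset Strict Implicit.
Unset Printing Implicit Defensive.

Import GRing.Theory.
Local Open Scope ring_scope.

(** * Exponentials of power series, through truncations *)

Section ExpSeries.
Variable R : comAlgType rat.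

Lemma natr_algE n : (n%:R : rat)%:A = n%:R :> R.
Proof. by rewrite scaler_nat. Qed.

Lemma mulr_natI n (x y : R) : (0 < n)%N -> n%:R * x = n%:R * y -> x = y.
Proof.
move=> n_gt0 /(congr1 ( *:%R (n%:R : rat)^-1)).
rewrite !mulr_natl -!scaler_nat !scalerA mulVf ?scale1r //.
by rewrite Num.Theory.pnatr_eq0 -lt0n.
Qed.

Lemma eq_coefM k (p p' g g' : {poly R}) :
  (forall i, (i <= k)%N -> p`_i = p'`_i) ->
  (forall i, (i <= k)%N -> g`_i = g'`_i) ->
  forall i, (i <= k)%N -> (p * g)`_i = (p' * g')`_i.
Proof.
move=> eqp eqg i le_ik; rewrite !coefM; apply: eq_bigr => j _.
rewrite eqp ?eqg //; first exact: leq_trans (leq_subr _ _) le_ik.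
by apply: leq_trans le_ik; rewrite -ltnS.
Qed.

Lemma eq_coefX n k (p p' : {poly R}) :
  (forall i, (i <= k)%N -> p`_i = p'`_i) ->
  forall i, (i <= k)%N -> (p ^+ n)`_i = (p' ^+ n)`_i.
Proof.
by move=> eqp; elim: n => [|n IHn] // i; rewrite !exprS; apply: eq_coefM.
Qed.

Lemma coefX_lt (p : {poly R}) n k : p`_0 = 0 -> (k < n)%N -> (p ^+ n)`_k = 0.
Proof.
move=> p0 lt_kn.
have -> : p = drop_poly 1 p * 'X.
  rewrite -{1}(poly_take_drop 1 p) expr1 [take_poly _ _](_ : _ = 0) ?add0r //.
  by apply/polyP=> i; rewrite coef_take_poly coef0; case: i.
by rewrite exprMn_comm ?coefMXn ?lt_kn //; apply: mulrC.
Qed.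

Variables (f : nat -> R) (N : nat).
Hypothesis f0 : f 0 = 0.
Let F := \poly_(j < N.+1) f j.
(** [exp_coef] truncates at a degree that varies with the coefficient. The single polynomial [G] is
    right in all degrees up to [N], so it can be differentiated. *)
Let G := \sum_(n < N.+1) (n`!%:R : rat)^-1%:A *: F ^+ n.

Lemma exp_coefE k : (k <= N)%N -> exp_coef f k = G`_k.
Proof.
move=> le_kN; rewrite /exp_coef coef_sum.
rewrite (big_ord_widen_cond N.+1 xpredT
  (fun n => (n`!%:R : rat)^-1 *: ((\poly_(j < k.+1) f j) ^+ n)`_k)) //=.
rewrite [LHS]big_mkcond; apply: eq_bigr => n _; rewrite coefZ mulr_algl.
case: ifPn => [_|]; last first.
  rewrite -ltnNge => lt_kn; rewrite coefX_lt ?scaler0 //.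
  by rewrite coef_poly.
congr (_ *: _); apply: (@eq_coefX _ k) => // i le_ik.
by rewrite !coef_poly ltnS le_ik ltnS (leq_trans le_ik).
Qed.

(** This is (exp F)' = F' exp F. Truncation loses the term F' F^N / N!; as [F] has no constant term,
    z F' F^N vanishes in degrees up to [N]. *)
Lemma coef_deriv_exp k : (k <= N)%N ->
  ('X * G^`())`_k = ('X * F^`() * G)`_k.
Proof.
move=> le_kN; have -> : G^`() = F^`() * (G - (N`!%:R : rat)^-1%:A *: F ^+ N).
  rewrite {2}/G big_ord_recr /= addrK mulr_sumr raddf_sum /= big_ord_recl /=.
  rewrite expr0 derivZ derivC scaler0 add0r.
  apply: eq_bigr => n _; rewrite derivZ deriv_exp /bump /= add1n -scalerAr.
  rewrite -[_ *+ n.+1]scaler_nat scalerA; congr (_ *: _).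
  rewrite -natr_algE mulr_algl scalerA factS natrM invfM mulrAC mulVf ?mul1r //.
  by rewrite Num.Theory.pnatr_eq0.
rewrite mulrBr mulrBr mulrA coefB -!scalerAr coefZ.
rewrite [F^`() * _]mulrC mulrA [('X * F ^+ N * _)`_k]coefM.
rewrite big1 ?mulr0 ?subr0 // => i _.
rewrite coefXM; case: eqP => [|/eqP i0]; first by rewrite mul0r.
rewrite coefX_lt ?mul0r ?coef_poly //.
by case: (nat_of_ord i) i0 (ltn_ord i) => // j _; rewrite ltnS => /leq_trans->.
Qed.

Lemma exp_coef_rec k : (k <= N)%N ->
  k%:R * exp_coef f k =
    \sum_(j < k.+1) j%:R * f j * exp_coef f (k - j).
Proof.
move=> le_kN; have := coef_deriv_exp le_kN; rewrite coefXM coefM coef_deriv.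
have -> : (if k == 0 then 0 else G`_k.-1.+1 *+ k.-1.+1) = k%:R * exp_coef f k.
  by rewrite exp_coefE // mulr_natl; case: k {le_kN}.
move=> ->; apply: eq_bigr => j _.
have le_jN : (j <= N)%N by apply: leq_trans le_kN; rewrite -ltnS.
rewrite exp_coefE ?(leq_trans (leq_subr _ _)) // coefXM coef_deriv; congr (_ * _).
case: j le_jN => -[|j] /= _ le_jN; first by rewrite mul0r.
by rewrite coef_poly ltnS le_jN mulr_natl.
Qed.

End ExpSeries.

(** * Pfaffians and their directional derivatives *)

Section Pfaffian.
Variable R : comAlgType rat.

(** The derivative of [Pf] at [A] in the direction [D], by the Leibniz rule for the product over the
    pairs. *)
Definition Pf_deriv m (A D : 'I_m.*2 -> 'I_m.*2 -> R) : R :=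
  ((2 ^ m * m`!)%:R : rat)^-1 *:
    \sum_(s : 'S_(m.*2)) (-1) ^+ s * \sum_(j < m)
      D (s (ord_even j)) (s (ord_odd j)) *
      \prod_(i < m | i != j) A (s (ord_even i)) (s (ord_odd i)).

Lemma ord_even_inj m : injective (@ord_even m).
Proof. by move=> i j /(congr1 val)/= /double_inj/val_inj. Qed.

Lemma ord_odd_inj m : injective (@ord_odd m).
Proof. by move=> i j /(congr1 val)/= [] /double_inj/val_inj. Qed.

Lemma ord_even_odd m (i j : 'I_m) : (ord_even i == ord_odd j) = false.
Proof.
by apply/negP=> /eqP/(congr1 (fun x : 'I_m.*2 => odd x)) /=; rewrite !odd_double.
Qed.

Lemma ord_odd_even m (i j : 'I_m) : (ord_odd i == ord_even j) = false.
Proof. by rewrite eq_sym ord_even_odd. Qed.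

Lemma ord_even_eq m (i j : 'I_m) : (ord_even i == ord_even j) = (i == j).
Proof. exact: (inj_eq (@ord_even_inj m)). Qed.

Lemma ord_odd_eq m (i j : 'I_m) : (ord_odd i == ord_odd j) = (i == j).
Proof. exact: (inj_eq (@ord_odd_inj m)). Qed.

Lemma big_double (V : nmodType) m (g : 'I_m.*2 -> V) :
  \sum_x g x = \sum_(j < m) (g (ord_even j) + g (ord_odd j)).
Proof.
elim: m g => [|m IHm] g; first by rewrite !big_ord0.
rewrite [RHS]big_ord_recr /= (big_ord_recr m.*2.+1) /= big_ord_recr /= -addrA.
congr (_ + (g _ + g _)); try exact: val_inj.
pose w := widen_ord (leqW (leqnSn m.*2)).
transitivity (\sum_x g (w x)).
  by apply: eq_bigr => x _; congr g; apply: val_inj.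
by rewrite IHm; apply: eq_bigr => j _; congr (g _ + g _); apply: val_inj.
Qed.

(** A permutation puts distinct indices in the two positions of a pair. [PfM_add_parts] relies on
    this: for x = y, raising one part would raise both. *)
Lemma eq_Pf_deriv m (A D D' : 'I_m.*2 -> 'I_m.*2 -> R) :
  (forall x y, x != y -> D x y = D' x y) -> Pf_deriv A D = Pf_deriv A D'.
Proof.
move=> eqD; congr (_ *: _); apply: eq_bigr => s _; congr (_ * _).
by apply: eq_bigr => j _; rewrite eqD // (inj_eq (@perm_inj _ s)) ord_even_odd.
Qed.

Lemma Pf_deriv_sum m (A : 'I_m.*2 -> 'I_m.*2 -> R) n (c : 'I_n -> R)
    (D : 'I_n -> 'I_m.*2 -> 'I_m.*2 -> R) :
  Pf_deriv A (fun x y => \sum_(k < n) c k * D k x y)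
  = \sum_(k < n) c k * Pf_deriv A (D k).
Proof.
rewrite /Pf_deriv.
under [RHS]eq_bigr => k _ do rewrite -scalerAr mulr_sumr.
rewrite -scaler_sumr exchange_big /=; congr (_ *: _); apply: eq_bigr => s _.
under [RHS]eq_bigr => k _ do rewrite mulrCA mulr_sumr.
rewrite -mulr_sumr exchange_big /=; congr (_ * _); apply: eq_bigr => j _.
by rewrite mulr_suml; apply: eq_bigr => k _; rewrite mulrA.
Qed.

Lemma Pf_derivZ m (A D : 'I_m.*2 -> 'I_m.*2 -> R) c :
  Pf_deriv A (fun x y => c * D x y) = c * Pf_deriv A D.
Proof.
have := Pf_deriv_sum A (fun k : 'I_1 => c) (fun=> D).
by rewrite big_ord1 => <-; apply: eq_Pf_deriv => x y _; rewrite big_ord1.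
Qed.

(* Each index lies in exactly one pair of a perfect matching. *)
Lemma sum_Pf_row m (w : 'I_m.*2 -> R) (A : 'I_m.*2 -> 'I_m.*2 -> R)
    (B : 'I_m.*2 -> 'I_m.*2 -> 'I_m.*2 -> R) :
  (forall i x y, x != i -> y != i -> B i x y = A x y) ->
  \sum_i w i * Pf (\matrix_(x, y) B i x y)
  = Pf_deriv A (fun x y => w x * B x x y + w y * B y x y).
Proof.
move=> eqB; rewrite /Pf_deriv /Pf.
under [LHS]eq_bigr => i _ do rewrite -scalerAr mulr_sumr.
rewrite -scaler_sumr exchange_big /=; congr (_ *: _); apply: eq_bigr => s _.
under [LHS]eq_bigr => i _ do rewrite mulrCA.
rewrite -mulr_sumr; congr (_ * _).
rewrite (reindex_inj (@perm_inj _ s)) /= big_double; apply: eq_bigr => j _.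
rewrite mulrDl -!mulrA.
congr (_ + _); rewrite (bigD1 j) //= !mxE; congr (_ * (_ * _));
  by apply: eq_bigr => i ne_ij; rewrite !mxE eqB // (inj_eq (@perm_inj _ s))
    ?ord_even_odd ?ord_odd_even ?ord_even_eq ?ord_odd_eq.
Qed.

(** * Permutations that fix the last one or two points *)

Lemma sum_lift_perm n (g : 'S_n.+1 -> R) :
  \sum_(s : 'S_n.+1 | s ord_max == ord_max) g s
  = \sum_s g (lift_perm ord_max ord_max s).
Proof.
have h_inj : injective (@lift_perm n ord_max ord_max).
  move=> s u eq_su; apply/permP=> x; apply: (@lift_inj _ ord_max).
  by rewrite -!(lift_perm_lift ord_max) eq_su.
pose h' (s : 'S_n.+1) :=
  odflt 1%g [pick u | lift_perm ord_max ord_max u == s].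
have hK u : h' (lift_perm ord_max ord_max u) = u.
  rewrite /h'; case: pickP => [v /eqP/h_inj //|/(_ u)]; by rewrite eqxx.
rewrite (reindex_onto (lift_perm ord_max ord_max) h') /=.
  by apply: eq_bigl => u; rewrite lift_perm_id hK !eqxx.
move=> s /eqP s_max; rewrite /h'; case: pickP => [v /eqP //|no_u].
(* The restriction of [s] refutes [no_u]. Since [s] is injective and fixes [ord_max], [unlift]
   succeeds here and the default x is never taken. *)
pose v x := odflt x (unlift ord_max (s (lift ord_max x))).
have vK x : lift ord_max (v x) = s (lift ord_max x).
  rewrite /v; case: unliftP => //= e.
  have /perm_inj/eqP := etrans e (esym s_max).
  by rewrite eq_sym (negbTE (neq_lift _ _)).
have v_inj : injective v.
  move=> x y /(congr1 (lift ord_max)); rewrite !vK.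
  by move/perm_inj/lift_inj.
have /eqP[] := no_u (perm v_inj); apply/permP=> x.
case: (unliftP ord_max x) => [y|] ->; last by rewrite lift_perm_id s_max.
by rewrite lift_perm_lift permE vK.
Qed.

Definition lift2 n (x : 'I_n) : 'I_n.+2 := lift ord_max (lift ord_max x).
Definition ord_max2 n : 'I_n.+2 := lift ord_max ord_max.
Definition lift2_perm n (s : 'S_n) : 'S_n.+2 :=
  lift_perm ord_max ord_max (lift_perm ord_max ord_max s).

Lemma lift2_val n (x : 'I_n) : lift2 x = x :> nat.
Proof. by rewrite /lift2 !lift_max. Qed.

Lemma ord_max2_val n : ord_max2 n = n :> nat.
Proof. exact: lift_max. Qed.

Lemma lift2_permE n (s : 'S_n) x : lift2_perm s (lift2 x) = lift2 (s x).
Proof. by rewrite !lift_perm_lift. Qed.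

Lemma lift2_perm_max n (s : 'S_n) : lift2_perm s ord_max = ord_max.
Proof. exact: lift_perm_id. Qed.

Lemma lift2_perm_max2 n (s : 'S_n) : lift2_perm s (ord_max2 n) = ord_max2 n.
Proof. by rewrite lift_perm_lift lift_perm_id. Qed.

Lemma odd_lift2_perm n (s : 'S_n) : lift2_perm s = s :> bool.
Proof. by rewrite !odd_lift_perm !addbb. Qed.

Lemma sum_lift2_perm n (g : 'S_n.+2 -> R) :
  \sum_(s : 'S_n.+2 | (s ord_max == ord_max) && (s (ord_max2 n) == ord_max2 n))
    g s = \sum_s g (lift2_perm s).
Proof.
rewrite big_mkcondr sum_lift_perm.
under eq_bigr => u _ do rewrite lift_perm_lift (inj_eq (@lift_inj _ _)).
by rewrite -big_mkcond sum_lift_perm.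
Qed.

(** * Expansion of a Pfaffian along its last two indices *)

Section Expand.
Variables (m : nat) (B : 'I_m.+1.*2 -> 'I_m.+1.*2 -> R).
Hypothesis B_asym : forall x y, B y x = - B x y.

Let f (s : 'S_(m.+1.*2)) : R :=
  (-1) ^+ s * \prod_(i < m.+1) B (s (ord_even i)) (s (ord_odd i)).

Let last : 'I_m.+1.*2 := ord_odd ord_max.
Let last2 : 'I_m.+1.*2 := ord_even ord_max.

(** The sign of the transposition cancels against the antisymmetry of [B]. *)
Let f_flip j s : f (tperm (ord_even j) (ord_odd j) * s) = f s.
Proof.
rewrite /f odd_permM odd_tperm ord_even_odd /= signrN.
rewrite (bigD1 j) //= [in RHS](bigD1 j) //= !permM tpermL tpermR B_asym.
rewrite !mulNr mulrN opprK; congr (_ * (_ * _)).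
apply: eq_bigr => i ne_ij; have ne_ji : j != i by rewrite eq_sym.
by rewrite !permM !tpermD ?ord_even_eq ?ord_odd_eq ?ord_even_odd ?ord_odd_even.
Qed.

(** Exchanging two whole pairs is an even permutation and only reorders the product. *)
Let f_swap j s :
  f (tperm (ord_even j) last2 * (tperm (ord_odd j) last * s)) = f s.
Proof.
rewrite /f !odd_permM !odd_tperm ord_even_eq ord_odd_eq addbA addbb addFb.
congr (_ * _); rewrite [RHS](reindex_inj (@perm_inj _ (tperm j ord_max))) /=.
have swapE x :
    tperm (ord_even j) last2 (ord_even x) = ord_even (tperm j ord_max x).
  by rewrite [RHS](inj_tperm _ _ _ (@ord_even_inj _)).
have swapO x : tperm (ord_odd j) last (ord_odd x) = ord_odd (tperm j ord_max x).
  by rewrite [RHS](inj_tperm _ _ _ (@ord_odd_inj _)).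
apply: eq_bigr => i _; rewrite !permM swapE [tperm (ord_even j) _ _]tpermD
  ?ord_even_odd // swapO [tperm (ord_odd j) _ _]tpermD ?ord_odd_even //.
Qed.

(* Permuting the pairs, and the two entries of a pair, brings the last index to
   the last position. *)
Let sum_f_last :
  \sum_s f s = (m.+1.*2)%:R * \sum_(s : 'S_(m.+1.*2) | s last == last) f s.
Proof.
have odd_pos j : \sum_(s : 'S_(m.+1.*2) | s (ord_odd j) == last) f s
    = \sum_(s : 'S_(m.+1.*2) | s last == last) f s.
  rewrite (reindex_inj
    (mulgI (tperm (ord_even j) last2 * tperm (ord_odd j) last)%g)).
  apply: eq_big => s; last by rewrite -mulgA f_swap.
  by rewrite !permM [tperm _ last2 _]tpermD ?ord_even_odd // tpermL.
have even_pos j : \sum_(s : 'S_(m.+1.*2) | s (ord_even j) == last) f s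
    = \sum_(s : 'S_(m.+1.*2) | s last == last) f s.
  rewrite -(odd_pos j) (reindex_inj (mulgI (tperm (ord_even j) (ord_odd j)))).
  by apply: eq_big => s; rewrite ?f_flip // permM tpermL.
rewrite (partition_big (fun s : 'S_(m.+1.*2) => (s^-1)%g last) xpredT) //=.
have eqp x : \sum_(s : 'S_(m.+1.*2) | (s^-1)%g last == x) f s =
     \sum_(s : 'S_(m.+1.*2) | s x == last) f s.
  by apply: eq_bigl => s; rewrite -(inj_eq (@perm_inj _ s)) permKV eq_sym.
rewrite big_double
  (eq_bigr (fun=> 2%:R * \sum_(s : 'S_(m.+1.*2) | s last == last) f s)).
  by rewrite sumr_const card_ord -mulrnAl -mulrnA mul2n.
by move=> j _; rewrite !eqp even_pos odd_pos mulr_natl mulr2n.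
Qed.

(** Well typed because [m.+1.*2] is convertible to [m.*2.+2]; its image is the complement of [last2]
    and [last]. *)
Let w : 'I_m.*2 -> 'I_m.+1.*2 := @lift2 m.*2.

Let even_w (i : 'I_m) : ord_even (widen_ord (leqnSn m) i) = w (ord_even i).
Proof. by apply: val_inj; rewrite [RHS]lift2_val. Qed.

Let odd_w (i : 'I_m) : ord_odd (widen_ord (leqnSn m) i) = w (ord_odd i).
Proof. by apply: val_inj; rewrite [RHS]lift2_val. Qed.

Let last2E : last2 = @ord_max2 m.*2.
Proof. by apply: val_inj; rewrite [RHS]ord_max2_val. Qed.

Let lastE : last = @ord_max m.*2.+1.
Proof. exact: val_inj. Qed.

Let ws : 'S_m.*2 -> 'S_(m.+1.*2) := @lift2_perm m.*2.

Let sum_ws (g : 'S_(m.+1.*2) -> R) :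
  \sum_(s : 'S_(m.+1.*2) | (s last == last) && (s last2 == last2)) g s
  = \sum_(s : 'S_m.*2) g (ws s).
Proof. rewrite lastE last2E; exact: sum_lift2_perm. Qed.

Let ws_w s x : ws s (w x) = w (s x).
Proof. exact: lift2_permE. Qed.

Let ws_last s : ws s last = last.
Proof. rewrite lastE; exact: lift2_perm_max. Qed.

Let ws_last2 s : ws s last2 = last2.
Proof. rewrite last2E; exact: lift2_perm_max2. Qed.

Let odd_ws s : ws s = s :> bool.
Proof. exact: odd_lift2_perm. Qed.

Let w_last x : (w x == last) = false.
Proof. by rewrite lastE eq_sym; apply/negbTE/neq_lift. Qed.

Let w_last2 x : (w x == last2) = false.
Proof.
by rewrite last2E (inj_eq lift_inj) eq_sym; apply/negbTE/neq_lift.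
Qed.

Let w_inj : injective w.
Proof. by move=> x y /lift_inj/lift_inj. Qed.

Let f_lift2 s :
  f (ws s) = B last2 last * ((-1) ^+ s *
    \prod_(i < m) B (w (s (ord_even i))) (w (s (ord_odd i)))).
Proof.
rewrite /f odd_ws big_ord_recr /= -/last -/last2 ws_last ws_last2.
rewrite [RHS]mulrC -mulrA; congr (_ * (_ * _)); apply: eq_bigr => i _.
by rewrite even_w odd_w !ws_w.
Qed.

(** The j-th pair becomes ([last2], [w (s (ord_odd j))]). Reversing it by antisymmetry cancels the
    sign of the transposition. *)
Let f_lift2_even j s :
  f (tperm (w (ord_even j)) last2 * ws s) = (-1) ^+ s *
    (B (w (s (ord_even j))) last * B (w (s (ord_odd j))) last2 *
    \prod_(i < m | i != j) B (w (s (ord_even i))) (w (s (ord_odd i)))).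
Proof.
rewrite /f odd_permM odd_tperm w_last2 /= signrN odd_ws mulNr -mulrN.
congr (_ * _); rewrite big_ord_recr /= -/last -/last2 (bigD1 j) //=.
rewrite even_w odd_w !permM tpermL tpermR !tpermD ?ord_even_odd ?w_last //;
  rewrite ?(inj_eq w_inj) ?ord_even_odd // 1?eq_sym ?w_last2 //.
rewrite !ws_w ws_last ws_last2 B_asym mulNr mulrC mulrN opprK mulrA.
congr (_ * _); apply: eq_bigr => i ne_ij.
rewrite even_w odd_w !permM !tpermD ?(inj_eq w_inj) ?ord_even_odd ?ord_even_eq //;
  rewrite 1?eq_sym ?w_last2 //.
by rewrite !ws_w.
Qed.

(** Here [last2] already stands second in the j-th pair, so the sign of the transposition
    survives. *)
Let f_lift2_odd j s :
  f (tperm (w (ord_odd j)) last2 * ws s) = (-1) ^+ s *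
    (- (B (w (s (ord_odd j))) last * B (w (s (ord_even j))) last2) *
    \prod_(i < m | i != j) B (w (s (ord_even i))) (w (s (ord_odd i)))).
Proof.
rewrite /f odd_permM odd_tperm w_last2 /= signrN odd_ws mulNr -mulrN.
congr (_ * _); rewrite big_ord_recr /= -/last -/last2 (bigD1 j) //=.
rewrite even_w odd_w !permM tpermL tpermR !tpermD ?ord_odd_even ?w_last //;
  rewrite ?(inj_eq w_inj) ?ord_odd_even // 1?eq_sym ?w_last2 //;
  last by rewrite ord_odd_even.
rewrite !ws_w ws_last ws_last2 mulrC !mulNr mulrA; congr (- (_ * _)).
apply: eq_bigr => i ne_ij.
rewrite even_w odd_w !permM !tpermD ?(inj_eq w_inj) ?ord_odd_even ?ord_odd_eq //;
  rewrite 1?eq_sym ?w_last2 //.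
by rewrite !ws_w.
Qed.

(* If the last two indices are not paired, last2 is exchanged with the partner
   of last. *)
Let sum_f_w x :
  \sum_(s : 'S_(m.+1.*2) | (s last == last) && (s (w x) == last2)) f s
  = \sum_(s : 'S_m.*2) f (tperm (w x) last2 * ws s).
Proof.
rewrite -(sum_ws (fun s => f (tperm (w x) last2 * s))).
rewrite (reindex_inj (mulgI (tperm (w x) last2))) /=.
apply: eq_bigl => s; rewrite !permM tpermL tpermD // ?w_last //.
by rewrite ord_even_odd.
Qed.

(** With [last] kept in the last position, sort the permutations by the position of [last2]. If it
    is paired with [last], the smaller Pfaffian remains; if it lies in another pair, its even and
    odd positions give the two products of the direction. *)
Lemma Pf_expand :
  Pf (\matrix_(x, y) B x y) =
    B last2 last * Pf (\matrix_(x, y) B (w x) (w y))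
    + Pf_deriv (fun x y => B (w x) (w y))
        (fun x y => B (w x) last * B (w y) last2 - B (w y) last * B (w x) last2).
Proof.
rewrite /Pf.
under eq_bigr => s _ do under eq_bigr => i _ do rewrite mxE.
under [in RHS]eq_bigr => s _ do under eq_bigr => i _ do rewrite mxE.
(* The factor [m.+1.*2] of [sum_f_last] is the quotient of the normalizations 2^(m+1) (m+1)! and 2^m
   m!. *)
rewrite [LHS](_ : _ = ((2 ^ m * m`!)%:R : rat)^-1 *:
    \sum_(s : 'S_(m.+1.*2) | s last == last) f s); last first.
  rewrite sum_f_last -natr_algE mulr_algl scalerA; congr (_ *: _).
  have nz2m : (2 ^ m)%:R != 0 :> rat by rewrite Num.Theory.pnatr_eq0 expn_eq0.
  have nzf : m`!%:R != 0 :> rat by rewrite Num.Theory.pnatr_eq0 -lt0n fact_gt0.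
  have nzm : m.+1%:R != 0 :> rat by rewrite Num.Theory.pnatr_eq0.
  rewrite -mul2n expnS factS !natrM.
  move: (2 ^ m)%:R m`!%:R m.+1%:R nz2m nzf nzm => a b c a0 b0 c0.
  by field; rewrite a0 b0 c0.
rewrite -scalerAr /Pf_deriv -scalerDr; congr (_ *: _).
rewrite (partition_big (fun s : 'S_(m.+1.*2) => (s^-1)%g last2) xpredT) //=.
have eqp x :
    \sum_(s : 'S_(m.+1.*2) | (s last == last) && ((s^-1)%g last2 == x)) f s =
    \sum_(s : 'S_(m.+1.*2) | (s last == last) && (s x == last2)) f s.
  apply: eq_bigl => s; rewrite -[_ last2 == x](inj_eq (@perm_inj _ s)).
  by rewrite permKV [s x == _]eq_sym.
rewrite big_double big_ord_recr /= -/last -/last2 addrC !eqp.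
(* The position [last] holds the index [last], so it contributes an empty sum. *)
rewrite sum_ws [X in _ + X + _]big1 ?addr0 => [|s /andP[/eqP-> /eqP]]; last first.
  by move/eqP; rewrite /last2 ord_odd_even.
rewrite mulr_sumr; congr (_ + _); first by apply: eq_bigr => s _; exact: f_lift2.
under eq_bigr => j _ do rewrite !eqp even_w odd_w !sum_f_w -big_split.
rewrite exchange_big /=; apply: eq_bigr => s _; rewrite mulr_sumr.
apply: eq_bigr => j _; rewrite f_lift2_even f_lift2_odd -mulrDr.
by rewrite -mulrDl.
Qed.

End Expand.
End Pfaffian.

(** * Identities for the q and for the entries M *)

Section SchurQIdentities.
Variables (R : comAlgType rat) (t : nat -> R).

Local Notation q := (q t).
Local Notation M := (M t).

Let h j : R := if odd j then 2 * t j else 0.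

Lemma q0 : q 0 = 1.
Proof.
by rewrite /Defs.q /exp_coef big_ord_recl big_ord0 /= coefC invr1 scale1r addr0.
Qed.

Lemma q_rec n : n%:R * q n = \sum_(j < n.+1) j%:R * h j * q (n - j).
Proof. exact: exp_coef_rec. Qed.

Section Truncation.
Variable n : nat.
(** Modulo z^(n+1), [Q] is q(z) and [Qm] is q(-z); [H], [DQ] and [DQm] are z d/dz of the exponent,
    of q(z) and of q(-z). *)
Let Q := \poly_(k < n.+1) q k.
Let Qm := \poly_(k < n.+1) ((-1) ^+ k * q k).
Let H := \poly_(k < n.+1) (k%:R * h k).
Let DQ := \poly_(k < n.+1) (k%:R * q k).
Let DQm := \poly_(k < n.+1) (k%:R * ((-1) ^+ k * q k)).

Let coefM_poly (f g : nat -> R) i : (i <= n)%N ->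
  (\poly_(k < n.+1) f k * \poly_(k < n.+1) g k)`_i
  = \sum_(k < i.+1) f k * g (i - k)%N.
Proof.
move=> le_in; rewrite coefM; apply: eq_bigr => k _; rewrite !coef_poly.
by rewrite !ltnS (leq_trans (leq_subr _ _) le_in) (leq_trans _ le_in) // -ltnS.
Qed.

Let coef_DQ i : (i <= n)%N -> DQ`_i = (H * Q)`_i.
Proof. by move=> le_in; rewrite coefM_poly // coef_poly ltnS le_in q_rec. Qed.

(** As [h] lives in odd degrees, replacing z by -z in [coef_DQ] changes the sign of [H]. *)
Let coef_DQm i : (i <= n)%N -> DQm`_i = (- (H * Qm))`_i.
Proof.
move=> le_in; rewrite coefN coefM_poly // coef_poly ltnS le_in mulrCA q_rec.
rewrite mulr_sumr -sumrN; apply: eq_bigr => -[j /= lt_ji] _; rewrite /h.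
case: ifP => [odd_j|]; last by rewrite !(mulr0, mul0r) oppr0.
have -> : (-1) ^+ i = (-1) ^+ (i - j) * (-1) ^+ j :> R by rewrite -exprD subnK.
by rewrite -(signr_odd _ j) odd_j expr1; ring.
Qed.

(** By the two previous facts z d/dz kills q(-z) q(z), and a positive degree i is invertible in a
    rational algebra. *)
Let coef_QmQ i : (i <= n)%N -> (Qm * Q)`_i = (1 : {poly R})`_i.
Proof.
move=> le_in; rewrite coef1; case: (posnP i) => [->|i_gt0].
  by rewrite coefM_poly // big_ord_recl big_ord0 /= q0 !mulr1 addr0.
apply: (@mulr_natI R i) => //; rewrite mulr0.
have -> : i%:R * (Qm * Q)`_i = (DQm * Q + Qm * DQ)`_i.
  rewrite coefD !coefM_poly // -big_split mulr_sumr.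
  apply: eq_bigr => -[k /= lt_ki] _.
  by rewrite -{1}(subnKC (_ : k <= i)%N) // natrD; ring.
rewrite coefD (@eq_coefM _ i _ (- (H * Qm)) _ Q) //; last first.
  by move=> j le_ji; apply: coef_DQm; apply: leq_trans le_in.
rewrite (@eq_coefM _ i Qm Qm _ (H * Q)) //; last first.
  by move=> j le_ji; apply: coef_DQ; apply: leq_trans le_in.
by rewrite -coefD mulNr mulrCA mulrA addNr coef0.
Qed.

Lemma q_orthogonal :
  \sum_(k < n.+1) (-1) ^+ k * q k * q (n - k) = (n == 0%N)%:R.
Proof. by rewrite -coef1 -coef_QmQ // coefM_poly. Qed.

Lemma power_sum_q : odd n ->
  2 * (n%:R * t n) = \sum_(k < n.+1) k%:R * q k * ((-1) ^+ (n - k) * q (n - k)).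
Proof.
move=> odd_n; transitivity (DQ * Qm)`_n; last by rewrite coefM_poly.
rewrite (@eq_coefM _ n _ (H * Q) _ Qm) //.
rewrite -mulrA (@eq_coefM _ n H H _ 1) // => [|k le_kn]; last first.
  by rewrite mulrC coef_QmQ.
by rewrite mulr1 coef_poly ltnSn /h odd_n; ring.
Qed.

End Truncation.

Lemma q_orthogonal_gt0 n : (0 < n)%N ->
  \sum_(k < n.+1) (-1) ^+ k * q k * q (n - k) = 0.
Proof. by move=> n_gt0; rewrite q_orthogonal gtn_eqF. Qed.

Lemma ME a b : (0 < a + b)%N ->
  M a b = q a * q b + 2 * \sum_(i < b) (-1) ^+ i.+1 * q (a + i.+1) * q (b - i.+1).
Proof.
rewrite /Defs.M -addn_eq0 lt0n => /negbTE->; congr (_ + 2 * _).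
by rewrite big_add1 big_mkord.
Qed.

Lemma M_00 : M 0 0 = 0. Proof. by []. Qed.

Lemma M_r0 a : (0 < a)%N -> M a 0 = q a.
Proof. by move=> a_gt0; rewrite ME ?addn0 // big_ord0 q0; ring. Qed.

(** Apart from the first term of the sum in [M a b.+1], the two sums agree up to sign and a shift of
    the index. All later recursions rest on this relation. *)
Lemma M_shift1 a b : M a.+1 b + M a b.+1 = q a * q b.+1 - q a.+1 * q b.
Proof.
rewrite !ME ?addnS // big_ord_recl /= !addn1 subSS subn0 expr1.
have -> : \sum_(i < b) (-1) ^+ (bump 0 i).+1 * q (a + (bump 0 i).+1)
      * q (b.+1 - (bump 0 i).+1)
    = - \sum_(i < b) (-1) ^+ i.+1 * q (a.+1 + i.+1) * q (b - i.+1).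
  rewrite -sumrN; apply: eq_bigr => i _.
  by rewrite /bump add1n subSS addSnnS exprS; ring.
by ring.
Qed.

(** The right-hand side of [M_shift1] is antisymmetric, so induction lowers one index to 0. There
    the claim is [q_orthogonal_gt0], or the convention [M 0 0 = 0]. *)
Lemma M_asym a b : M b a = - M a b.
Proof.
suff W c d : M d c + M c d = 0.
  by apply/eqP; rewrite -addr_eq0 W.
elim: c d => [|c IHc] d; last first.
  transitivity (- (M d.+1 c + M c d.+1)); last by rewrite IHc oppr0.
  have -> : M d c.+1 = q d * q c.+1 - q d.+1 * q c - M d.+1 c.
    by rewrite -M_shift1; ring.
  have -> : M c.+1 d = q c * q d.+1 - q c.+1 * q d - M c d.+1.
    by rewrite -M_shift1; ring.
  by ring.
case: d => [|d]; first by rewrite /Defs.M addr0.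
rewrite M_r0 // ME // q0; have := @q_orthogonal_gt0 d.+1 isT.
rewrite big_ord_recl /= q0 subn0 !mul1r addrC => /eqP; rewrite addr_eq0 => /eqP e.
rewrite [X in 2 * X](_ : _ = - q d.+1); first by ring.
by rewrite -e; apply: eq_bigr => i _; rewrite /bump add1n.
Qed.

(** With M_a(z) the sum of the M_(a,l) z^l, [qM] and [MM] are the coefficients of z^r in q(-z)
    M_b(z) and in M_a(-z) M_b(z). *)
Definition qM b r := \sum_(l < r.+1) (-1) ^+ l * q l * M b (r - l).
Definition MM a b r := \sum_(l < r.+1) (-1) ^+ l * M a l * M b (r - l).

Lemma qM_0 b : (0 < b)%N -> qM b 0 = q b.
Proof. by move=> b0; rewrite /qM big_ord1 q0 M_r0 //; ring. Qed.

(** Apply [M_shift1] to each M_(b,r+1-l) with l <= r. Orthogonality makes the multiple of q_b cancel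
    the term l = r + 1, and leaves q_(b+1) only for r = 0. *)
Lemma qM_rec b r : (0 < b)%N -> qM b r.+1 = - qM b.+1 r - q b.+1 * (r == 0%N)%:R.
Proof.
move=> b0; rewrite /qM big_ord_recr /= subnn M_r0 // -q_orthogonal.
have := @q_orthogonal_gt0 r.+1 isT; rewrite big_ord_recr /= subnn q0 mulr1.
move=> /eqP; rewrite addrC addr_eq0 => /eqP->; rewrite /qM.
have -> : \sum_(l < r.+1) (-1) ^+ l * q l * M b (r.+1 - l)
    = q b * (\sum_(l < r.+1) (-1) ^+ l * q l * q (r.+1 - l))
      - q b.+1 * (\sum_(l < r.+1) (-1) ^+ l * q l * q (r - l))
      - \sum_(l < r.+1) (-1) ^+ l * q l * M b.+1 (r - l).
  rewrite !mulr_sumr -!sumrB; apply: eq_bigr => -[l /= lt_lr] _.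
  rewrite subSn //.
  have -> : M b (r - l).+1
      = q b * q (r - l).+1 - q b.+1 * q (r - l) - M b.+1 (r - l).
    by rewrite -M_shift1; ring.
  by ring.
by ring.
Qed.

Lemma qM_S b r : (0 < b)%N -> qM b r.+1 = 2 * (-1) ^+ r.+1 * q (b + r.+1).
Proof.
elim: r b => [|r IHr] b b0; rewrite qM_rec //.
  by rewrite qM_0 // addn1 /=; ring.
by rewrite IHr // /= addSnnS [_ ^+ r.+2]exprS; ring.
Qed.

(** [M_shift1] is applied to the first factor; the term l = 0, where M_(a,0) = q_a q_0, completes
    the convolution [qM b r.+1]. *)
Lemma MM_rec a b r : (0 < a)%N ->
  MM a b r.+1 = MM a.+1 b r + q a * qM b r.+1 + q a.+1 * qM b r.
Proof.
move=> a0; rewrite /MM /qM big_ord_recl [in X in q a * X]big_ord_recl /= !subn0.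
have -> : \sum_(i < r.+1)
      (-1) ^+ bump 0 i * M a (bump 0 i) * M b (r.+1 - bump 0 i)
    = \sum_(i < r.+1) (-1) ^+ i * M a.+1 i * M b (r - i)
      + q a * (\sum_(i < r.+1)
          (-1) ^+ bump 0 i * q (bump 0 i) * M b (r.+1 - bump 0 i))
      + q a.+1 * (\sum_(i < r.+1) (-1) ^+ i * q i * M b (r - i)).
  rewrite !mulr_sumr -!big_split; apply: eq_bigr => i _.
  rewrite /bump add1n subSS.
  have -> : M a i.+1 = q a * q i.+1 - q a.+1 * q i - M a.+1 i.
    by rewrite -M_shift1; ring.
  by rewrite exprS /=; ring.
by rewrite M_r0 // q0; ring.
Qed.

(** In the induction on r, the products of q added by [MM_rec] are those by which [M_shift1] turns
    M_(a+1,b+r) into -M_(a,b+r+1). *)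
Lemma MM_S a b r : (0 < a)%N -> (0 < b)%N ->
  MM a b r.+1 = 2 * (-1) ^+ r.+1 * M a (b + r.+1) - 2 * M (a + r.+1) b.
Proof.
move=> + b0; elim: r a => [|r IHr] a a0; rewrite MM_rec // qM_S //.
  have -> : M a (b + 1) = q a * q b.+1 - q a.+1 * q b - M a.+1 b.
    by rewrite -M_shift1 addn1; ring.
  by rewrite /MM big_ord1 !M_r0 // qM_0 // !addn1; ring.
rewrite IHr // qM_S //.
have -> : M a (b + r.+2)
    = q a * q (b + r.+2) - q a.+1 * q (b + r.+1) - M a.+1 (b + r.+1).
  by rewrite !addnS -M_shift1; ring.
by rewrite addSnnS [_ ^+ r.+2]exprS; ring.
Qed.

Lemma sign_subn_odd r l : odd r -> (l <= r)%N ->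
  (-1) ^+ (r - l) = - (-1) ^+ l :> R.
Proof.
by move=> odd_r le_lr; rewrite -signr_odd oddB // odd_r signrN signr_odd.
Qed.

(** M_(0,l) is -q_l for l > 0, but M_(0,0) is 0 instead of -1. So [MM a 0 r] is the reversed
    [qM a r] without one term, namely M_(a,r). *)
Lemma MM_r0 a r : (0 < a)%N -> odd r -> MM a 0 r = - (2 * M (a + r) 0 + M a r).
Proof.
move=> a0; case: r => // r odd_r; rewrite M_r0 ?addn_gt0 ?a0 //.
have sg : (-1) ^+ r.+1 = -1 :> R by rewrite -signr_odd odd_r.
have e : qM a r.+1 = MM a 0 r.+1 + M a r.+1.
  transitivity (\sum_(l < r.+2) - ((-1) ^+ l * M a l * q (r.+1 - l))).
    rewrite /qM (reindex_inj rev_ord_inj) /=; apply: eq_bigr => -[l /= lt_lr] _.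
    by rewrite subSS sign_subn_odd // subKn //; ring.
  rewrite /MM big_ord_recr [in RHS]big_ord_recr /= subnn M_00 q0 sg.
  rewrite mulr0 addr0 mulN1r mulr1 opprK; congr (_ + _).
  apply: eq_bigr => -[l /= lt_lr] _.
  by rewrite [M 0 _]M_asym M_r0 ?subn_gt0 //; ring.
have := qM_S r a0; rewrite e sg => /(canRL (addrK _)) ->.
by ring.
Qed.

Lemma MM_asym a b r : odd r -> MM b a r = - MM a b r.
Proof.
move=> odd_r; rewrite /MM (reindex_inj rev_ord_inj) -sumrN.
apply: eq_bigr => -[l /= lt_lr] _; rewrite subSS subKn //.
by rewrite sign_subn_odd //; ring.
Qed.

(* A zero part of s stands for the completion of a partition of odd length; as
   M 0 0 is 0 instead of q 0 * q 0 = 1, adding r to it counts for half. *)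
Definition part_weight (a : nat) : rat := if a == 0%N then 1 / 2 else 1.

Lemma M_shift a b r : odd r ->
  2 * ((part_weight a)%:A * M (a + r) b + (part_weight b)%:A * M a (b + r))
  = - MM a b r.
Proof.
(* Both sides are antisymmetric, so if just one part is 0 it may be taken to be b, as in [MM_r0]. *)
move=> odd_r; wlog: a b / (b <= a)%N.
  move=> IH; case: (leqP b a) => [/IH //|/ltnW /IH e].
  rewrite -MM_asym // -[MM b a r]opprK -e.
  by rewrite [M (a + r) b]M_asym [M a (b + r)]M_asym; ring.
have half : (1 / 2 : rat)%:A * 2 = 1 :> R.
  by rewrite -(natr_algE R 2) mulr_algl scalerA mulfVK ?scale1r.
rewrite /part_weight; case: a => [|a].
  rewrite leqn0 => /eqP->; rewrite eqxx [M (0 + r) 0]M_asym.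
  have -> : MM 0 0 r = 0.
    apply: (@mulr_natI R 2) => //; rewrite mulr0 mulr_natl mulr2n.
    by rewrite {1}MM_asym // addNr.
  by ring.
case: b => [_|b _] /=; rewrite !scale1r.
  move: (_ *: 1) half => c half; rewrite MM_r0 // add0n.
  rewrite mulrDr [2 * (c * _)](_ : _ = c * 2 * M a.+1 r); last by ring.
  by rewrite half; ring.
by case: r odd_r => // r odd_r; rewrite MM_S // -signr_odd odd_r; ring.
Qed.

(** By [ME] the k-th summand is p_k plus twice the sum of the p_j with j > k. The p_k add up to 0,
    and each p_j occurs for j values of k, which gives the sum of [power_sum_q]. *)
Lemma power_sum_M r : odd r ->
  4 * (r%:R * t r) = \sum_(k < r.+1) (-1) ^+ (r - k) * M k (r - k).
Proof.
move=> odd_r; pose p k := q k * ((-1) ^+ (r - k) * q (r - k)).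
have sum_p : \sum_(k < r.+1) p k = 0.
  have := @q_orthogonal_gt0 r (odd_gt0 odd_r) => /(congr1 -%R).
  rewrite oppr0 -sumrN => e0; apply: etrans e0.
  by apply: eq_bigr => -[k /= lt_kr] _; rewrite /p sign_subn_odd //; ring.
rewrite (eq_bigr (fun k : 'I_r.+1 => p k + 2 * \sum_(j < r.+1 | (k < j)%N) p j)).
  rewrite big_split /= sum_p add0r -mulr_sumr (exchange_big_dep xpredT) //=.
  transitivity (2 * (2 * (r%:R * t r))); first by ring.
  rewrite power_sum_q //; congr (2 * _); apply: eq_bigr => -[j /= lt_jr] _.
  rewrite -(big_ord_widen r.+1 (fun=> p j)) 1?ltnW // sumr_const card_ord.
  by rewrite -[RHS]mulr_natl -mulrA.
move=> [k /= lt_kr] _; rewrite ME ?subnKC ?odd_gt0 // mulrDr mulrCA /p.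
rewrite [q k * _ in LHS]mulrC; congr (_ + _); first by ring.
rewrite mulrCA; congr (2 * _).
rewrite -(big_geq_mkord k.+1 r.+1 xpredT p) -{1}[k.+1]add0n big_addn.
rewrite subSS big_mkord mulr_sumr.
(* The substitution is j = i + k + 1; the two copies of the sign of i + 1 square to 1. *)
apply: eq_bigr => -[i /= lt_i] _; rewrite /p.
have -> : (r - (i + k.+1) = r - k - i.+1)%N by rewrite -subnDA addnS -addSn addnC.
have -> : (-1) ^+ (r - k) = (-1) ^+ (r - k - i.+1) * (-1) ^+ i.+1 :> R.
  by rewrite -exprD subnK.
have -> : (i + k.+1 = k + i.+1)%N by rewrite addnC addSnnS.
move: ((-1) ^+ i.+1) (sqrr_sign R i.+1) => s ss.
transitivity (s ^+ 2 * (q (k + i.+1) *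
    ((-1) ^+ (r - k - i.+1) * q (r - k - i.+1)))); first by ring.
by rewrite ss mul1r.
Qed.

End SchurQIdentities.

(** * The power sum times a Pfaffian, then times a Schur Q-polynomial *)

Lemma set_nth_rcons (T : Type) (x0 x y : T) s i : (i < size s)%N ->
  set_nth x0 (rcons s x) i y = rcons (set_nth x0 s i y) x.
Proof. by elim: s i => [|z s IHs] [|i] //= /IHs->. Qed.

Lemma set_nth_rcons_size (T : Type) (x0 x y : T) s :
  set_nth x0 (rcons s x) (size s) y = rcons s y.
Proof. by elim: s => //= z s ->. Qed.

Section PowerSum.
Variables (R : comAlgType rat) (t : nat -> R).

Local Notation M := (M t).

Lemma PfM_sub m s f : size s = m.*2 ->
  (forall x : 'I_m.*2, nth 0%N s x = f x) ->
  PfM t s = Pf (\matrix_(x < m.*2, y < m.*2) M (f x) (f y)).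
Proof.
move=> sz_s nthE; rewrite (@PfM_sizeE _ _ m) ?sz_s ?doubleK //.
by congr Pf; apply/matrixP=> x y; rewrite !mxE !nthE.
Qed.

(** Raising part i changes only row and column i, so [sum_Pf_row] gives a derivative, whose
    direction [M_shift] computes. *)
Lemma PfM_add_parts m s r : size s = m.*2 -> odd r ->
  2 * (\sum_(i < size s) (part_weight (nth 0%N s i))%:A * PfM t (add_part s r i))
  = - Pf_deriv (fun x y : 'I_m.*2 => M (nth 0%N s x) (nth 0%N s y))
        (fun x y => MM t (nth 0%N s x) (nth 0%N s y) r).
Proof.
move=> sz_s odd_r.
pose B (i x y : 'I_m.*2) :=
  M (nth 0%N (add_part s r i) x) (nth 0%N (add_part s r i) y).
rewrite sz_s (eq_bigr (fun i : 'I_m.*2 =>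
  (part_weight (nth 0%N s i))%:A * Pf (\matrix_(x, y) B i x y))); last first.
  move=> i _; congr (_ * _); apply: PfM_sub => //.
  by rewrite size_set_nth sz_s; apply/maxn_idPr.
rewrite (sum_Pf_row _ (A := fun x y : 'I_m.*2 => M (nth 0%N s x) (nth 0%N s y))).
  rewrite -Pf_derivZ -mulN1r -Pf_derivZ; apply: eq_Pf_deriv => x y ne_xy.
  rewrite mulN1r -M_shift // /B /add_part !nth_set_nth /= !eqxx.
  by rewrite !(inj_eq val_inj) (negbTE ne_xy) eq_sym (negbTE ne_xy).
move=> i x y ne_xi ne_yi; rewrite /B /add_part !nth_set_nth /=.
by rewrite !(inj_eq val_inj) (negbTE ne_xi) (negbTE ne_yi).
Qed.

Lemma PfM_cat2 m s k l : size s = m.*2 ->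
  PfM t (s ++ [:: k; l]) = M k l * PfM t s +
    Pf_deriv (fun x y : 'I_m.*2 => M (nth 0%N s x) (nth 0%N s y))
      (fun x y => M (nth 0%N s x) l * M (nth 0%N s y) k
                  - M (nth 0%N s y) l * M (nth 0%N s x) k).
Proof.
move=> sz_s; pose s' := s ++ [:: k; l].
have sz_s' : size s' = m.+1.*2 by rewrite size_cat sz_s addn2.
rewrite (PfM_sub (m := m.+1) (f := fun x => nth 0%N s' x)) //.
rewrite (@Pf_expand _ m (fun x y => M (nth 0%N s' x) (nth 0%N s' y))); last first.
  by move=> x y; apply: M_asym.
have nthk : nth 0%N s' (@ord_even m.+1 ord_max) = k.
  by rewrite /s' nth_cat sz_s ltnn subnn.
have nthl : nth 0%N s' (@ord_odd m.+1 ord_max) = l.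
  by rewrite /s' nth_cat sz_s ltnNge leqnSn subSnn.
have nthw (x : 'I_m.*2) : nth 0%N s' (lift2 x) = nth 0%N s x.
  by rewrite lift2_val /s' nth_cat sz_s ltn_ord.
rewrite nthk nthl (PfM_sub (m := m) (f := fun x => nth 0%N s' (lift2 x))) //.
congr (_ + _); rewrite /Pf_deriv; congr (_ *: _); apply: eq_bigr => u _.
congr (_ * _); apply: eq_bigr => j _; rewrite !nthw; congr (_ * _).
by apply: eq_bigr => i _; rewrite !nthw.
Qed.

Lemma PfM_power_sum s r : ~~ odd (size s) -> odd r ->
  4 * (r%:R * t r * PfM t s)
  = 4 * \sum_(i < size s) (part_weight (nth 0%N s i))%:A * PfM t (add_part s r i)
    + \sum_(k < r.+1) (-1) ^+ (r - k) * PfM t (s ++ [:: k : nat; r - k]%N).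
Proof.
move=> even_s odd_r; have sz_s : size s = (size s)./2.*2 by rewrite even_halfK.
rewrite (_ : 4 * \sum_i _ = 2 * (2 * \sum_(i < size s)
  (part_weight (nth 0%N s i))%:A * PfM t (add_part s r i))); last by ring.
rewrite (PfM_add_parts sz_s) //.
under eq_bigr => k _ do rewrite (PfM_cat2 _ _ sz_s) mulrDr mulrA.
rewrite big_split /= -mulr_suml -power_sum_M // -Pf_deriv_sum.
(* The summed direction is [MM t a b r - MM t b a r], which is twice [MM t a b r] for odd r; it
   cancels the derivative from [PfM_add_parts]. *)
rewrite [X in _ = _ + (_ + X)](_ : _ = 2 * Pf_deriv
        (fun x y : 'I_(size s)./2.*2 => M (nth 0%N s x) (nth 0%N s y))
        (fun x y => MM t (nth 0%N s x) (nth 0%N s y) r)).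
  by ring.
rewrite -Pf_derivZ; apply: eq_Pf_deriv => x y _.
move: (nth 0%N s x) (nth 0%N s y) => a b.
rewrite (reindex_inj rev_ord_inj) /=.
transitivity (MM t a b r - MM t b a r); last first.
  by rewrite [MM t b a r]MM_asym //; ring.
rewrite /MM -sumrB; apply: eq_bigr => -[l /= lt_lr] _.
by rewrite subSS subKn //; ring.
Qed.

Lemma schurQ_pos s : 0%N \notin s ->
  schurQ t s = PfM t (if odd (size s) then rcons s 0%N else s).
Proof.
move=> s0; rewrite schurQE /= positive_part_id //.
by rewrite -[s in zero_inv s]cats0 zero_inv_cat // mul1r.
Qed.

Lemma add_part_pos s r i : 0%N \notin s -> (i < size s)%N ->
  0%N \notin add_part s r i.
Proof.
move=> s0 lt_i; apply/negP=> /(nthP 0%N)[j].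
rewrite size_set_nth (maxn_idPr lt_i) => lt_j.
have nz k : (k < size s)%N -> nth 0%N s k != 0%N.
  by move=> lt_k; apply: contraNneq s0 => <-; apply: mem_nth.
rewrite nth_set_nth /=; case: eqP => _ /eqP; last by rewrite (negbTE (nz _ _)).
by rewrite addn_eq0 (negbTE (nz _ _)).
Qed.

(** The terms k = 0 and k = r coincide: the sign (-1)^r = -1 undoes the swap of 0 and r. *)
Lemma PfM_power_sum_ends s r : ~~ odd (size s) -> odd r ->
  4 * (r%:R * t r * PfM t s)
  = 4 * \sum_(i < size s) (part_weight (nth 0%N s i))%:A * PfM t (add_part s r i)
    + 2 * PfM t (s ++ [:: r; 0]%N)
    + \sum_(1 <= k < r) (-1) ^+ (r - k) * PfM t (s ++ [:: k; r - k]%N).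
Proof.
move=> even_s odd_r; have r_gt0 := odd_gt0 odd_r.
rewrite PfM_power_sum // -addrA; congr (_ + _).
rewrite -(big_mkord xpredT (fun k =>
  (-1) ^+ (r - k) * PfM t (s ++ [:: k; r - k]%N))).
rewrite big_nat_recr //= big_ltn // subn0 subnn PfM_swap ?addn0 //.
by rewrite -signr_odd odd_r; ring.
Qed.

(** The term Q_(lam,r) has two origins. In even length it comes from the ends k = 0 and k = r. In
    odd length it comes from raising the added zero, with weight 1/2. *)
Lemma schurQ_power_sum lam r : 0%N \notin lam -> odd r ->
  4 * (r%:R * t r * schurQ t lam)
  = 4 * \sum_(i < size lam) schurQ t (add_part lam r i)
    + 2 * schurQ t (rcons lam r)
    + \sum_(1 <= k < r) (-1) ^+ (r - k) * schurQ t (lam ++ [:: k; r - k]%N).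
Proof.
move=> lam0 odd_r; have r_gt0 := odd_gt0 odd_r.
have nz k : (k < size lam)%N -> nth 0%N lam k != 0%N.
  by move=> lt_k; apply: contraNneq lam0 => <-; apply: mem_nth.
have lamr0 : 0%N \notin rcons lam r.
  by rewrite mem_rcons inE negb_or lam0 neq_ltn r_gt0.
have lamk0 k : (0 < k < r)%N -> 0%N \notin lam ++ [:: k; r - k]%N.
  case/andP=> k0 lt_kr; rewrite mem_cat !inE !negb_or lam0 !neq_ltn k0.
  by rewrite subn_gt0 lt_kr.
have sz_add i : (i < size lam)%N -> size (add_part lam r i) = size lam.
  by move=> lt_i; rewrite size_set_nth; apply/maxn_idPr.
have [odd_lam|even_lam] := boolP (odd (size lam)); last first.
  rewrite schurQ_pos // (negbTE even_lam) PfM_power_sum_ends //.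
  congr (_ * _ + _ * _ + _).
  - apply: eq_bigr => i _; rewrite schurQ_pos ?add_part_pos // sz_add //.
    by rewrite (negbTE even_lam) /part_weight (negbTE (nz _ _)) // scale1r mul1r.
  - by rewrite schurQ_pos // size_rcons /= even_lam -cats1 -cats1 -catA.
  rewrite big_nat [RHS]big_nat; apply: eq_bigr => k k_r; congr (_ * _).
  by rewrite schurQ_pos ?lamk0 // size_cat addn2 /= negbK (negbTE even_lam).
rewrite schurQ_pos // odd_lam PfM_power_sum_ends ?size_rcons //= ?odd_lam //.
(* This sequence contains two zeros; once adjacent, exchanging them both fixes and negates the
   Pfaffian. *)
rewrite [PfM t (_ ++ [:: r; _])](_ : _ = 0); last first.
  rewrite cat_rcons PfM_swap ?addn1 /= ?odd_lam // -cat_rcons.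
  have := @PfM_swap _ t (rcons lam r) 0 0 [::].
  rewrite size_rcons addn0 /= odd_lam => /(_ isT) e.
  apply: (@mulr_natI _ 2) => //; rewrite mulr0 mulr_natl mulr2n {1}e.
  by rewrite opprK addrN.
have half : 4 * (1 / 2 : rat)%:A = 2 :> R.
  by rewrite -(natr_algE R 4) mulr_algl scalerA -(natr_algE R 2).
rewrite mulr0 addr0 big_ord_recr /= mulrDr nth_rcons ltnn eqxx mulrA half.
congr (4 * _ + 2 * _ + _).
- apply: eq_bigr => i _; rewrite schurQ_pos ?add_part_pos // sz_add // odd_lam.
  rewrite nth_rcons ltn_ord /part_weight (negbTE (nz _ _)) // scale1r mul1r.
  by congr PfM; rewrite /add_part nth_rcons ltn_ord set_nth_rcons ?ltn_ord.
- rewrite schurQ_pos // size_rcons /= odd_lam; congr PfM.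
  by rewrite /add_part nth_rcons ltnn eqxx set_nth_rcons_size.
rewrite big_nat [RHS]big_nat; apply: eq_bigr => k k_r; congr (_ * _).
rewrite schurQ_pos ?lamk0 // size_cat addn2 /= negbK odd_lam.
(* Two swaps carry the added zero past k and r - k to the end. *)
rewrite cat_rcons PfM_swap ?addn1 /= ?odd_lam // -!cats1 -catA /=.
rewrite -[in LHS]cat_rcons PfM_swap ?size_rcons ?addn0 /= ?odd_lam // opprK.
by rewrite cat_rcons.
Qed.

Lemma schurQ_power_sum_scale lam r : 0%N \notin lam -> odd r ->
  (r%:R : rat) *: (t r * schurQ t lam) =
    \sum_(i < size lam) schurQ t (add_part lam r i)
    + (1 / 2 : rat) *: schurQ t (rcons lam r)
    + \sum_(1 <= k < r)
        ((-1) ^+ (r - k) / 4 : rat) *: schurQ t (lam ++ [:: k; (r - k)%N]).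
Proof.
move=> lam0 odd_r; apply: (@mulr_natI _ 4) => //.
transitivity (4 * (r%:R * t r * schurQ t lam)).
  by rewrite -(natr_algE R r) -[in RHS]mulrA mulr_algl.
rewrite schurQ_power_sum // !mulrDr mulr_sumr; congr (_ + _ + _).
  by rewrite -(natr_algE _ 4) mulr_algl scalerA -(natr_algE _ 2) mulr_algl.
rewrite mulr_sumr; apply: eq_bigr => k _.
rewrite -(natr_algE _ 4) mulr_algl scalerA.
by rewrite mulrCA mulfV // mulr1 -[in RHS]signr_odd scaler_sign
  -[in LHS]signr_odd mulr_sign.
Qed.

End PowerSum.

Theorem lemma2p2 (lam : seq nat) (r : nat) :
  strict lam -> odd r ->
  (r%:R : rat) *: (tvar r * schurQ tvar lam) =
    \sum_(i < size lam) schurQ tvar (add_part lam r i)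
    + (1 / 2 : rat) *: schurQ tvar (rcons lam r)
    + \sum_(1 <= k < r)
        ((-1) ^+ (r - k) / 4 : rat) *: schurQ tvar (lam ++ [:: k; (r - k)%N]).
Proof.
by case/andP=> _ lam0 odd_r; apply: schurQ_power_sum_scale.
Qed.
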